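(* Let $A_1,A_2\in\mathbb{R}^{N\times N}$ be the lower triangular matrices with entries, for $1\le n\le N$, $$(A_1)_{n,1}=\tfrac{\Delta_t}{2}v(x_0,t_n),\qquad (A_1)_{n,k}=\Delta_t\,v(x_0,t_{n-k+1})\ (2\le k\le n),$$ $$(A_2)_{n,1}=\tfrac{\Delta_t}{2}v^2(x_0,t_n),\qquad (A_2)_{n,k}=\Delta_t\,v^2(x_0,t_{n-k+1})\ (2\le k\le n),$$ and zero entries for $k>n$, where $t_n=n\Delta_t$, $\Delta_t=T/N$, the mesh being such that $v(x_0,t_1)>0$. Let $\vec E=(E(t_1),\dots,E(t_N))^T$ and $\vec V=(V(t_1),\dots,V(t_N))^T$ with $E(t_n)=\mathbb{E}[I_t^{1-\alpha}u(x_0,t_n,\omega)]$, $V(t_n)=\mathbb{V}[I_t^{1-\alpha}u(x_0,t_n,\omega)]$, and let $\vec g_1,\vec g_2\in\mathbb{R}^N$ be the vectors solving $A_1\vec g_1=\vec E$, $A_2\vec g_2=\vec V$. For $\delta>0$ let $\vec E_\delta,\vec V_\delta\in\mathbb{R}^N$ be noisy data with componentwise relative error at most $\delta$: $$|(\vec E_\delta)_n-E(t_n)|\le\delta|E(t_n)|,\qquad |(\vec V_\delta)_n-V(t_n)|\le\delta|V(t_n)|,\qquad n=1,\dots,N.$$ Let $\gamma_1,\gamma_2>0$, let $\vec g_{1,0},\vec g_{2,0}\in\mathbb{R}^N$ be initial vectors, and define for $k\ge0$ $$\vec g_{1,k+1}=\vec g_{1,k}+(A_1^TA_1+\gamma_1I)^{-1}A_1^T(\vec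 E_\delta-A_1\vec g_{1,k}),$$ $$\vec g_{2,k+1}=\vec g_{2,k}+(A_2^TA_2+\gamma_2I)^{-1}A_2^T(\vec V_\delta-A_2\vec g_{2,k}).$$ Then the sequences $\{\vec g_{1,k}\}_{k=0}^\infty$ and $\{\vec g_{2,k}\}_{k=0}^\infty$ are both convergent, and, denoting their limits by $\vec g_{1,\delta}$ and $\vec g_{2,\delta}$ respectively, $$\lim_{\delta\to0+}\|\vec g_{1,\delta}-\vec g_1\|_\infty=\lim_{\delta\to0+}\|\vec g_{2,\delta}-\vec g_2\|_\infty=0.$$
   Context: Setting: $T\in(0,\infty)$, $\alpha\in(1/2,1)$, and $D\subset\mathbb{R}^d$ ($d=1,2,3$) is a bounded domain with sufficiently smooth boundary. $\mathcal{A}:H^2(D)\to L^2(D)$, $\mathcal{A}\psi=-\nabla\cdot(\kappa(x)\nabla\psi)$, is an elliptic operator (with $\kappa$ a sufficiently regular, uniformly positive coefficient). $\partial_t^\alpha$ is the Djrbashyan-Caputo derivative $\partial_t^\alpha\psi(t)=\frac1{\Gamma(1-\alpha)}\int_0^t(t-\tau)^{-\alpha}\psi'(\tau)\,d\tau$. For $\beta\in(0,1)$, $I_t^\beta\psi(t)=\frac1{\Gamma(\beta)}\int_0^t(t-\tau)^{\beta-1}\psi(\tau)\,d\tau$. $I$ without indices is the identity matrix. Standing assumptions: $g_1,g_2\in L^\infty(0,T)$ are deterministic and $g_1$ changes sign only finitely many times on $(0,T)$; $f\in H^2(D)\cap H_0^1(D)$ with $0\le f(x)\le C_f<\infty$ on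 $D$; $x_0\in D$, $x_0\notin\operatorname{supp}(f)$, in particular $f(x_0)=0$. $v$ is the solution of $\partial_t^\alpha v+\mathcal{A}v=0$ in $D\times(0,T]$, $v=0$ on $\partial D\times(0,T]$, $v(\cdot,0)=f$ in $D$. $(\Omega,\mathcal{F},P)$ is a probability space carrying a standard Brownian motion $\mathbb{W}$; $\dot{\mathbb{W}}$ is the associated white noise; $\mathbb{E}$ and $\mathbb{V}$ denote expectation and variance. Write $g(t,\omega)=g_1(t)+g_2(t)\dot{\mathbb{W}}(t)$ and $I_t^\alpha g(t,\omega)=I_t^\alpha g_1(t)+\frac1{\Gamma(\alpha)}\int_0^t(t-\tau)^{\alpha-1}g_2(\tau)\,d\mathbb{W}(\tau)$ (Ito integral). $u$ is the stochastic weak solution of $\partial_t^\alpha u+\mathcal{A}u=f(x)g(t,\omega)$ in $D\times(0,T]$, $u=0$ on $\partial D\times(0,T]$, $u(\cdot,0)=0$, i.e. a process $u(\cdot,t,\omega):(0,T]\times\Omega\to L^2(D)$ with $\langle u(\cdot,t,\omega),\psi\rangle_{L^2(D)}+\langle I_t^\alpha\mathcal{A}u(\cdot,t,\omega),\psi\rangle_{L^2(D)}=I_t^\alpha g(t,\omega)\langle f,\psi\rangle_{L^2(D)}$ for each $\psi\in H^2(D)\cap H_0^1(D)$, $\omega\in\Omega$, $t\in(0,T]$. It is known that $u(x,t,\omega)=I_t^\alpha g(t,\omega)f(x)+\int_0^tI_\tau^\alpha g(\tau,\omega)v_t(x,t-\tau)\,d\tau$, and point values $u(x_0,t,\omega)$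 are understood through this formula. *)

(* Defs.v *)
From HB Require Import structures.
From mathcomp Require Import all_boot all_order all_algebra.
From mathcomp Require Import all_classical all_reals all_analysis.
Set Implicit Arguments. Unset Strict Implicit. Unset Printing Implicit Defensive.
Import Order.TTheory GRing.Theory Num.Theory numFieldNormedType.Exports.
Local Open Scope classical_set_scope.
Local Open Scope ring_scope.

Definition coord_sets (R : realType) (d : nat) : set (set 'rV[R]_d) :=
  [set A | exists (i : 'I_d) (B : set R), measurable B /\ A = [set x : 'rV[R]_d | B (x ord0 i)]].

(* Row vectors with the sigma-algebra generated by the coordinates, i.e. the
   Borel sigma-algebra of R^d.  [Rd R d] is convertible to ['rV[R]_d]. *)
Definition Rd (R : realType) (d : nat) := g_sigma_algebraType (@coord_sets R d).

Definition rV_cons (R : realType) (d : nat) (p : R * Rd R d) : Rd R d.+1 :=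
  \row_i (if unlift ord0 i is Some j then p.2 ord0 j else p.1).

Definition rV_uncons (R : realType) (d : nat) (x : Rd R d.+1) : R * Rd R d :=
  (x ord0 ord0, \row_j x ord0 (lift ord0 j)).

Lemma rV_consK (R : realType) (d : nat) : cancel (@rV_cons R d) (@rV_uncons R d).
Proof.
move=> [a x]; rewrite /rV_uncons /rV_cons mxE unlift_none; congr (_, _).
by apply/rowP => j; rewrite !mxE liftK.
Qed.

Lemma measurable_coord (R : realType) (d : nat) (i : 'I_d) :
  measurable_fun setT (fun x : Rd R d => x ord0 i : R).
Proof.
move=> _ B mB; rewrite setTI; apply: sub_sigma_algebra; by exists i, B.
Qed.

Lemma measurable_to_Rd (R : realType) (d : nat) d' (T : measurableType d')
    (h : T -> Rd R d) :
  (forall i, measurable_fun setT (fun t => h t ord0 i)) -> measurable_fun setT h.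
Proof.
move=> mh; apply: (@measurability _ _ _ _ setT h (@coord_sets R d)) => //.
by move=> _ [_ [i [B [mB ->]]] <-]; exact: mh.
Qed.

Lemma measurable_rV_cons (R : realType) (d : nat) :
  measurable_fun setT (@rV_cons R d).
Proof.
apply: measurable_to_Rd => i; case: (unliftP ord0 i) => [j|] ->.
- rewrite [X in measurable_fun _ X](_ : _ = (fun x : Rd R d => x ord0 j) \o snd).
    by apply: measurableT_comp => //; exact: measurable_coord.
  by apply/funext => p /=; rewrite mxE liftK.
- rewrite [X in measurable_fun _ X](_ : _ = fst) //.
  by apply/funext => p /=; rewrite mxE unlift_none.
Qed.

Lemma measurable_rV_uncons (R : realType) (d : nat) :
  measurable_fun setT (@rV_uncons R d).
Proof.
apply: measurable_fun_pair; first exact: measurable_coord.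
apply: measurable_to_Rd => i.
rewrite [X in measurable_fun _ X](_ : _ = fun x : Rd R d.+1 => x ord0 (lift ord0 i)).
  exact: measurable_coord.
by apply/funext => x /=; rewrite mxE.
Qed.

HB.instance Definition _ (R : realType) (d : nat) :=
  @isMeasurableFun.Build _ _ _ _ (@rV_cons R d) (@measurable_rV_cons R d).

Definition cons_measure (R : realType) (d : nat)
    (m : {sigma_finite_measure set (Rd R d) -> \bar R}) :=
  pushforward (product_measure1 (@lebesgue_measure R) m) (@rV_cons R d).

Lemma cons_measure0 (R : realType) (d : nat)
    (m : {sigma_finite_measure set (Rd R d) -> \bar R}) :
  cons_measure m set0 = 0%E.
Proof. by apply: measure0; exact: measurable_rV_cons. Qed.

Lemma cons_measure_ge0 (R : realType) (d : nat)
    (m : {sigma_finite_measure set (Rd R d) -> \bar R}) A :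
  (0 <= cons_measure m A)%E.
Proof. by apply: measure_ge0; exact: measurable_rV_cons. Qed.

Lemma cons_measure_sigma_additive (R : realType) (d : nat)
    (m : {sigma_finite_measure set (Rd R d) -> \bar R}) :
  semi_sigma_additive (cons_measure m).
Proof. by apply: measure_semi_sigma_additive; exact: measurable_rV_cons. Qed.

HB.instance Definition _ (R : realType) (d : nat)
    (m : {sigma_finite_measure set (Rd R d) -> \bar R}) :=
  isMeasure.Build _ _ _ (cons_measure m) (cons_measure0 m)
    (cons_measure_ge0 m) (@cons_measure_sigma_additive R d m).

Lemma cons_measure_sigma_finite (R : realType) (d : nat)
    (m : {sigma_finite_measure set (Rd R d) -> \bar R}) :
  sigma_finite setT (cons_measure m).
Proof.
have /sigma_finiteP[F [TF ndF Foo]] := sigma_finiteT (@lebesgue_measure R).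
have /sigma_finiteP[G [TG ndG Goo]] := sigma_finiteT m.
exists (fun n => @rV_uncons R d @^-1` (F n `*` G n)).
  rewrite -preimage_bigcup -(preimage_setT (@rV_uncons R d)); congr (_ @^-1` _).
  rewrite -setXTT TF TG predeqE => -[x y]; split.
    move=> [/= [n _ Fnx] [k _ Gky]]; exists (maxn n k) => //; split.
    - by move: x Fnx; exact/subsetPset/ndF/leq_maxl.
    - by move: y Gky; exact/subsetPset/ndG/leq_maxr.
  by move=> [n _ []/= ? ?]; split; exists n.
move=> n; have [mF Fn] := Foo n; have [mG Gn] := Goo n; split.
  rewrite -[X in measurable X]setTI.
  by apply: measurable_rV_uncons => //; exact: measurableX.
rewrite /cons_measure /pushforward -comp_preimage.
rewrite (_ : _ \o _ = id); last by apply/funext => p; exact: rV_consK.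
by rewrite preimage_id product_measure1E// lte_mul_pinfty// ge0_fin_numE.
Qed.

HB.instance Definition _ (R : realType) (d : nat)
    (m : {sigma_finite_measure set (Rd R d) -> \bar R}) :=
  Measure_isSigmaFinite.Build _ _ _ (cons_measure m) (cons_measure_sigma_finite m).

(* d-fold product of the Lebesgue measure of R; see [lebesgue_Rd_box]. *)
Fixpoint lebesgue_Rd (R : realType) (d : nat) :
    {sigma_finite_measure set (Rd R d) -> \bar R} :=
  match d with
  | 0%N => @dirac _ (Rd R 0) (0 : 'rV[R]_0) R
  | d'.+1 => cons_measure (lebesgue_Rd R d')
  end.

Lemma lebesgue_Rd_box (R : realType) (d : nat) (a b : 'I_d -> R) :
  (forall i, a i <= b i) ->
  lebesgue_Rd R d [set x : 'rV[R]_d | forall i, x ord0 i \in `]a i, b i]] =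
  (\prod_i (b i - a i))%:E.
Proof.
elim: d a b => [|d IH] a b ab.
  by rewrite big_ord0 /= diracE mem_set// => -[].
rewrite [LHS](_ : _ = product_measure1 (@lebesgue_measure R) (lebesgue_Rd R d)
  ([set` `]a ord0, b ord0]] `*` [set x : 'rV[R]_d | forall i : 'I_d,
     x ord0 i \in `]a (lift ord0 i), b (lift ord0 i)]])).
  rewrite product_measure1E//; last first.
    rewrite (_ : mkset _ = \bigcap_(i in [set: 'I_d])
      ((fun x : Rd R d => x ord0 i : R) @^-1` [set` `]a (lift ord0 i), b (lift ord0 i)]])).
      apply: fin_bigcap_measurable => // i _.
      by rewrite -[X in measurable X]setTI; exact: measurable_coord.
    by apply/seteqP; split => x /= h i; [move=> _|]; exact: h.
  rewrite IH// big_ord_recl EFinM; congr (_ * _)%E.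
  rewrite [LHS](lebesgue_measure_itv `]a ord0, b ord0]) /= lte_fin -EFinB; case: ltP => // ba.
  by rewrite (_ : b ord0 = a ord0) ?subrr//; apply/eqP; rewrite eq_le ba ab.
rewrite /= /cons_measure /pushforward; congr product_measure1.
apply/seteqP; split => -[r x] /=.
  move=> h; split; first by have := h ord0; rewrite mxE unlift_none.
  by move=> i; have := h (lift ord0 i); rewrite mxE liftK.
move=> [hr hx] i; case: (unliftP ord0 i) => [j|] ->.
  by rewrite mxE liftK.
by rewrite mxE unlift_none.
Qed.

(* Elements of function spaces on [D] are represented by total functions
   ['rV[R]_d -> R], of which only the restriction to [D] matters. *)

Definition pd (R : realType) (d : nat) (i : 'I_d) (phi : 'rV[R]_d -> R) :
    'rV[R]_d -> R :=
  fun x => 'D_(delta_mx ord0 i) phi x.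

Definition iter_pd (R : realType) (d : nat) (s : seq 'I_d)
    (phi : 'rV[R]_d -> R) : 'rV[R]_d -> R :=
  foldr (@pd R d) phi s.

Definition Ck (R : realType) (d k : nat) (phi : 'rV[R]_d -> R) : Prop :=
  forall s : seq 'I_d, (size s <= k)%N ->
    continuous (iter_pd s phi) /\
    ((size s < k)%N ->
      forall (i : 'I_d) x, derivable (iter_pd s phi) x (delta_mx ord0 i)).

Definition test_fun (R : realType) (d : nat) (D : set 'rV[R]_d)
    (phi : 'rV[R]_d -> R) : Prop :=
  [/\ forall k, Ck k phi,
      compact (closure [set x | phi x != 0]) &
      closure [set x | phi x != 0] `<=` D].

Definition L2 (R : realType) (d : nat) (D : set 'rV[R]_d)
    (w : 'rV[R]_d -> R) : Prop :=
  measurable_fun (D : set (Rd R d)) (w : Rd R d -> R) /\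
  (\int[lebesgue_Rd R d]_(x in D) ((w x) ^+ 2)%:E < +oo)%E.

Definition L2dot (R : realType) (d : nat) (D : set 'rV[R]_d)
    (w z : 'rV[R]_d -> R) : R :=
  \int[lebesgue_Rd R d]_(x in D) (w x * z x).

Definition weak_pd (R : realType) (d : nat) (D : set 'rV[R]_d) (i : 'I_d)
    (w h : 'rV[R]_d -> R) : Prop :=
  forall phi, test_fun D phi -> L2dot D w (pd i phi) = - L2dot D h phi.

Definition weak_grad (R : realType) (d : nat) (D : set 'rV[R]_d)
    (w : 'rV[R]_d -> R) (dw : 'I_d -> 'rV[R]_d -> R) : Prop :=
  forall i, L2 D (dw i) /\ weak_pd D i w (dw i).

Definition H1 (R : realType) (d : nat) (D : set 'rV[R]_d)
    (w : 'rV[R]_d -> R) : Prop :=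
  L2 D w /\ exists dw, weak_grad D w dw.

Definition H2 (R : realType) (d : nat) (D : set 'rV[R]_d)
    (w : 'rV[R]_d -> R) : Prop :=
  L2 D w /\ exists2 dw, weak_grad D w dw & forall i, H1 D (dw i).

(* Closure of the test functions in H^1(D). *)
Definition H10 (R : realType) (d : nat) (D : set 'rV[R]_d)
    (w : 'rV[R]_d -> R) : Prop :=
  L2 D w /\ exists2 dw, weak_grad D w dw &
    exists phi : nat -> 'rV[R]_d -> R,
      [/\ forall n, test_fun D (phi n),
          (\int[lebesgue_Rd R d]_(x in D) ((phi n x - w x) ^+ 2)%:E)%E
            @[n --> \oo] --> 0%E &
          forall i, (\int[lebesgue_Rd R d]_(x in D)
              ((pd i (phi n) x - dw i x) ^+ 2)%:E)%E @[n --> \oo] --> 0%E].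

(* [elliptic D kappa w q]: w is in H^2(D) and q = - div (kappa grad w) in
   L^2(D). *)
Definition elliptic (R : realType) (d : nat) (D : set 'rV[R]_d)
    (kappa w q : 'rV[R]_d -> R) : Prop :=
  [/\ H2 D w, L2 D q &
      exists dw dF : 'I_d -> 'rV[R]_d -> R,
        [/\ weak_grad D w dw,
            forall i, L2 D (dF i) /\
              weak_pd D i (fun x => kappa x * dw i x) (dF i) &
            {ae lebesgue_Rd R d,
              forall x, D x -> q x = - \sum_i dF i x}]].

(* Near each of its boundary points, D is the sublevel set of a C^2 function
   with non-vanishing gradient. *)
Definition C2_boundary (R : realType) (d : nat) (D : set 'rV[R]_d) : Prop :=
  forall x, (closure D `\` D) x ->
    exists (U : set 'rV[R]_d) (rho : 'rV[R]_d -> R),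
      [/\ open U, U x, Ck 2 rho, (exists i, pd i rho x != 0) &
          D `&` U = [set y | U y /\ rho y < 0]].

Definition C2_domain (R : realType) (d : nat) (D : set 'rV[R]_d) : Prop :=
  [/\ open D, connected D, D !=set0, bounded_set D & C2_boundary D].

Definition elliptic_coef (R : realType) (d : nat) (D : set 'rV[R]_d)
    (kappa : 'rV[R]_d -> R) : Prop :=
  Ck 1 kappa /\ exists2 k0 : R, 0 < k0 & forall x, D x -> k0 <= kappa x.

Definition Gamma (R : realType) (z : R) : R :=
  \int[lebesgue_measure]_(x in `]0, +oo[) (x `^ (z - 1) * expR (- x)).

Definition frac_int (R : realType) (beta : R) (psi : R -> R) (t : R) : R :=
  (Gamma beta)^-1 *
  \int[lebesgue_measure]_(tau in `]0, t[) ((t - tau) `^ (beta - 1) * psi tau).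

Definition caputo (R : realType) (alpha : R) (psi : R -> R) (t : R) : R :=
  (Gamma (1 - alpha))^-1 *
  \int[lebesgue_measure]_(tau in `]0, t[)
    ((t - tau) `^ (- alpha) * derive1 psi tau).

Definition Linfty (R : realType) (T : R) (g : R -> R) : Prop :=
  measurable_fun `]0, T[ g /\
  exists C : R, {ae lebesgue_measure, forall t, t \in `]0, T[ -> `|g t| <= C}.

Definition finitely_many_sign_changes (R : realType) (T : R) (g : R -> R) :
    Prop :=
  exists (n : nat) (s : nat -> R),
    [/\ s 0%N = 0, s n = T &
        forall i, (i < n)%N -> s i < s i.+1 /\
          ({ae lebesgue_measure,
             forall t, t \in `]s i, s i.+1[ -> 0 <= g t} \/
           {ae lebesgue_measure,
             forall t, t \in `]s i, s i.+1[ -> g t <= 0})].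

(* d_t^alpha v + A v = 0 in D x (0,T],  v = 0 on the boundary,  v(.,0) = f.
   For d <= 3 the solution is continuous up to the boundary and up to t = 0,
   and is smooth in time for t > 0: [v] is this pointwise representative. *)
Record subdiffusion_solution (R : realType) (d : nat) (D : set 'rV[R]_d)
    (kappa f : 'rV[R]_d -> R) (alpha T : R) (v : 'rV[R]_d -> R -> R) : Prop := {
  sd_continuous :
    {within closure D `*` [set` `[0, T]], continuous (fun p => v p.1 p.2)} ;
  sd_derivable : forall x t, D x -> t \in `]0, T[ -> derivable (v x) t 1 ;
  sd_dt_integrable :
    (product_measure1 (lebesgue_Rd R d) (@lebesgue_measure R)).-integrable
      (D `*` [set` `]0, T[]) (fun p => (derive1 (v p.1) p.2)%:E) ;
  sd_dt_integrable_at : forall x, D x ->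
    (@lebesgue_measure R).-integrable `]0, T[ (fun t => (derive1 (v x) t)%:E) ;
  sd_caputo_integrable : forall x t, D x -> t \in `]0, T] ->
    (@lebesgue_measure R).-integrable `]0, t[
      (fun tau => ((t - tau) `^ (- alpha) * derive1 (v x) tau)%:E) ;
  sd_space : forall t, t \in `]0, T] -> H2 D (v^~ t) /\ H10 D (v^~ t) ;
  sd_equation : forall t, t \in `]0, T] ->
    exists2 Av, elliptic D kappa (v^~ t) Av &
      {ae lebesgue_Rd R d,
        forall x, D x -> caputo alpha (v x) t + Av x = 0} ;
  sd_boundary : forall x t,
    (closure D `\` D) x -> t \in `]0, T] -> v x t = 0 ;
  sd_initial : forall x, D x -> v x 0 = f x }.

(* [W] is indexed by R, but only the times t >= 0 matter. *)
Record brownian (R : realType) (dO : measure_display)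
    (Omega : measurableType dO) (P : probability Omega R)
    (W : R -> Omega -> R) : Prop := {
  bm_measurable : forall t, 0 <= t -> measurable_fun setT (W t) ;
  bm_0 : {ae P, forall omega, W 0 omega = 0} ;
  bm_continuous : {ae P, forall omega,
    {within [set` `[0, +oo[], continuous (W^~ omega)}} ;
  (* the increments are independent and N(0, t_(i+1) - t_i) distributed *)
  bm_increments : forall (n : nat) (t : nat -> R) (B : nat -> set R),
    0 <= t 0%N -> (forall i, (i < n)%N -> t i < t i.+1) ->
    (forall i, measurable (B i)) ->
    P (\bigcap_(i in [set i | (i < n)%N])
         [set omega | B i (W (t i.+1) omega - W (t i) omega)]) =
    (\prod_(i < n) normal_prob 0 (Num.sqrt (t i.+1 - t i)) (B i))%E }.

(* [X] is the Ito integral over (0,t) of the deterministic square-integrable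
   function [h]: the L^2(P)-limit of the integrals
   sum_j c_j (W(b_j) - W(a_j)) of step functions sum_j c_j 1_(a_j, b_j] that
   converge to h in L^2(0,t). *)
Definition ito_integral (R : realType) (dO : measure_display)
    (Omega : measurableType dO) (P : probability Omega R)
    (W : R -> Omega -> R) (t : R) (h : R -> R) (X : Omega -> R) : Prop :=
  [/\ measurable_fun `]0, t[ h, measurable_fun setT X &
    exists (m : nat -> nat) (a b c : nat -> nat -> R),
      [/\ forall k j, 0 <= a k j <= b k j /\ b k j <= t,
          (\int[lebesgue_measure]_(tau in `]0%R, t[)
             ((h tau - \sum_(j < m k)
                 c k j * \1_(`]a k j, b k j]%classic) tau) ^+ 2)%:E)%E
            @[k --> \oo] --> 0%E &
          (\int[P]_omega
             ((X omega - \sum_(j < m k)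
                 c k j * (W (b k j) omega - W (a k j) omega)) ^+ 2)%:E)%E
            @[k --> \oo] --> 0%E]].

(* [Ig] is the process I_t^alpha g of g = g1 + g2 dW/dt, in a version with
   continuous paths. *)
Definition frac_int_noise (R : realType) (dO : measure_display)
    (Omega : measurableType dO) (P : probability Omega R)
    (W : R -> Omega -> R) (alpha T : R) (g1 g2 : R -> R)
    (Ig : R -> Omega -> R) : Prop :=
  (forall omega, {within [set` `[0, T]], continuous (Ig^~ omega)}) /\
  forall t, t \in `]0, T] ->
    exists2 J, ito_integral P W t (fun tau => (t - tau) `^ (alpha - 1) * g2 tau) J
      & forall omega, Ig t omega = frac_int alpha g1 t + (Gamma alpha)^-1 * J omega.

(* d_t^alpha u + A u = f g in D x (0,T],  u = 0 on the boundary,  u(.,0) = 0.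
   A acts on H^2(D), so its use in the weak identity requires
   u(.,t) in H^2(D), and u = 0 on the boundary means u(.,t) in H^1_0(D).
   Joint integrability of [Au] makes the pointwise-in-x fractional integral
   coincide with the L^2(D)-valued one. *)
Record stochastic_weak_solution (R : realType) (d : nat) (D : set 'rV[R]_d)
    (kappa f : 'rV[R]_d -> R) (alpha T : R) (dO : measure_display)
    (Omega : measurableType dO) (Ig : R -> Omega -> R)
    (u : 'rV[R]_d -> R -> Omega -> R) : Prop := {
  sw_space : forall t omega, t \in `]0, T] ->
    H2 D (fun x => u x t omega) /\ H10 D (fun x => u x t omega) ;
  sw_weak : forall omega, exists Au : 'rV[R]_d -> R -> R,
    [/\ forall t, t \in `]0, T] ->
          elliptic D kappa (fun x => u x t omega) (Au^~ t),
        forall t, t \in `]0, T] ->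
          (product_measure1 (lebesgue_Rd R d) (@lebesgue_measure R)).-integrable
            (D `*` [set` `]0, t[])
            (fun p => ((t - p.2) `^ (alpha - 1) * Au p.1 p.2)%:E) /\
          L2 D (fun x => frac_int alpha (Au x) t) &
        forall t psi, t \in `]0, T] -> H2 D psi -> H10 D psi ->
          L2dot D (fun x => u x t omega) psi +
          L2dot D (fun x => frac_int alpha (Au x) t) psi =
          Ig t omega * L2dot D f psi] ;
  sw_initial : forall x omega, D x -> u x 0 omega = 0 }.

(* Point values of u are those given by this formula. *)
Definition solution_formula (R : realType) (d : nat) (D : set 'rV[R]_d)
    (f : 'rV[R]_d -> R) (T : R) (v : 'rV[R]_d -> R -> R)
    (dO : measure_display) (Omega : measurableType dO)
    (Ig : R -> Omega -> R) (u : 'rV[R]_d -> R -> Omega -> R) : Prop :=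
  forall x t omega, D x -> t \in `]0, T] ->
    u x t omega = Ig t omega * f x +
      \int[lebesgue_measure]_(tau in `]0, t[)
        (Ig tau omega * derive1 (v x) (t - tau)).

(* Indices are shifted by one: entry (i, j) is entry (n, k) = (i+1, j+1) in
   the usual numbering, so that t_n = (i+1) Dt and t_(n-k+1) = (i-j+1) Dt. *)

Definition mesh (R : realType) (Dt : R) (n : nat) : R := n%:R * Dt.

Definition quad_mx (R : realType) (N : nat) (Dt : R) (w : R -> R) : 'M[R]_N :=
  \matrix_(i < N, j < N)
    if (i < j)%N then 0
    else if j == 0%N :> nat then Dt / 2 * w (mesh Dt i.+1)
    else Dt * w (mesh Dt (i - j).+1).

Definition mean_data (R : realType) (dO : measure_display)
    (Omega : measurableType dO) (P : probability Omega R)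
    (alpha : R) (y : R -> Omega -> R) (t : R) : R :=
  fine ('E_P[fun omega => frac_int (1 - alpha) (y^~ omega) t])%E.

Definition variance_data (R : realType) (dO : measure_display)
    (Omega : measurableType dO) (P : probability Omega R)
    (alpha : R) (y : R -> Omega -> R) (t : R) : R :=
  fine ('V_P[fun omega => frac_int (1 - alpha) (y^~ omega) t])%E.

Fixpoint iter_tikhonov (R : realType) (N : nat) (A : 'M[R]_N) (gamma : R)
    (b g0 : 'cV[R]_N) (k : nat) : 'cV[R]_N :=
  if k is k'.+1 then
    let g := iter_tikhonov A gamma b g0 k' in
    g + invmx (A^T *m A + gamma%:M) *m (A^T *m (b - A *m g))
  else g0.

(* [bd] carries a componentwise relative error of at most [delta] on [b]. *)
Definition noisy (R : realType) (N : nat) (delta : R) (b bd : 'cV[R]_N) : Prop :=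
  forall n, `|bd n ord0 - b n ord0| <= delta * `|b n ord0|.

(* Main.v *)
(* The quadrature matrices are lower triangular with nonzero diagonal, hence
   invertible. Write B = A^T A + gamma I, and let e be the difference between an
   iterate and the exact solution A^-1 b. One step of the iteration replaces e
   by y with B y = gamma e. Testing this equation with y and using
   2 <y, e> <= |y|^2 + |e|^2 gives 2 |A y|^2 + gamma |y|^2 <= gamma |e|^2; as
   |y|^2 <= C |A y|^2 for invertible A, the squared Euclidean norm of the error
   decreases geometrically. So the limit is A^-1 b, which is continuous in b. *)
Require Import Defs.
From HB Require Import structures.
From mathcomp Require Import all_boot all_order all_algebra.
From mathcomp Require Import all_classical all_reals all_analysis.
From mathcomp Require Import lra.
Set Implicit Arguments.
Unset Strict Implicit.
Unset Printing Implicit Defensive.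
Import Order.TTheory GRing.Theory Num.Theory numFieldNormedType.Exports.
Local Open Scope classical_set_scope.
Local Open Scope ring_scope.

Lemma ler_entry_mx_norm (R : realType) m n (x : 'M[R]_(m, n)) i j :
  `|x i j| <= `|x|.
Proof.
by rewrite [leRHS]/Num.norm /= mx_normrE; apply/bigmax_geP; right; exists (i, j).
Qed.

Lemma mx_norm_le (R : realType) m n (x : 'M[R]_(m, n)) (c : R) :
  0 <= c -> (forall i j, `|x i j| <= c) -> `|x| <= c.
Proof.
move=> c0 xc; rewrite [leLHS]/Num.norm /= mx_normrE.
by apply/bigmax_leP; split=> // -[i j] _; exact: xc.
Qed.

(** The norm is the maximum of the absolute values of the entries, and each entry of the product is
    a sum of [n] terms; hence the factor [n]. *)
Lemma mx_norm_mul (R : realType) m n p (A : 'M[R]_(m, n)) (B : 'M[R]_(n, p)) :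
  `|A *m B| <= n%:R * (`|A| * `|B|).
Proof.
apply: mx_norm_le => [|i j]; first by rewrite !mulr_ge0.
rewrite mxE (le_trans (ler_norm_sum _ _ _))//.
rewrite (le_trans (y := \sum_(k < n) `|A| * `|B|))//.
  by apply: ler_sum => k _; rewrite normrM ler_pM// ler_entry_mx_norm.
by rewrite sumr_const card_ord mulr_natl.
Qed.

(** The iteration contracts in the Euclidean norm, while convergence is stated in the max norm.
    Squared lengths [dotmx x x] carry the energy estimate and are compared with the max norm in both
    directions below. *)
Definition dotmx (R : realType) n (x y : 'cV[R]_n) : R := (x^T *m y) 0 0.

Section Dotmx.
Variables (R : realType) (n : nat).
Implicit Types x y : 'cV[R]_n.

Lemma dotmxE x y : dotmx x y = \sum_i x i 0 * y i 0.
Proof. by rewrite /dotmx mxE; apply: eq_bigr => i _; rewrite mxE. Qed.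

Lemma dotmx_ge0 x : 0 <= dotmx x x.
Proof. by rewrite dotmxE sumr_ge0// => i _; rewrite -expr2 sqr_ge0. Qed.

Lemma dotmx_double x y : 2 * dotmx x y <= dotmx x x + dotmx y y.
Proof.
rewrite !dotmxE mulr_sumr -big_split /=; apply: ler_sum => i _.
by have := sqr_ge0 (x i 0 - y i 0); lra.
Qed.

Lemma sqr_mx_norm_le_dotmx x : `|x| ^+ 2 <= dotmx x x.
Proof.
rewrite -[leRHS]sqr_sqrtr ?dotmx_ge0// ler_sqr ?nnegrE ?sqrtr_ge0//.
apply: mx_norm_le => [|i j]; first exact: sqrtr_ge0.
rewrite (ord1 j) -sqrtr_sqr ler_wsqrtr// dotmxE (bigD1 i)//= -expr2 lerDl.
by rewrite sumr_ge0// => k _; rewrite -expr2 sqr_ge0.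
Qed.

Lemma dotmx_le_sqr_mx_norm x : dotmx x x <= n%:R * `|x| ^+ 2.
Proof.
rewrite dotmxE (le_trans (y := \sum_(k < n) `|x| ^+ 2))//.
  apply: ler_sum => k _; rewrite -expr2 -real_normK ?num_real//.
  by rewrite ler_sqr ?nnegrE// ler_entry_mx_norm.
by rewrite sumr_const card_ord mulr_natl.
Qed.

End Dotmx.

Section Tikhonov.
Variables (R : realType) (n : nat) (A : 'M[R]_n).
Implicit Types x y b : 'cV[R]_n.

Lemma dotmx_normal (gamma : R) y :
  dotmx y ((A^T *m A + gamma%:M) *m y) =
  dotmx (A *m y) (A *m y) + gamma * dotmx y y.
Proof.
rewrite /dotmx mulmxDl mulmxDr mxE; congr (_ + _).
  by rewrite trmx_mul !mulmxA.
by rewrite mul_scalar_mx -scalemxAr mxE.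
Qed.

Lemma unitmx_normal (gamma : R) : 0 < gamma ->
  A^T *m A + gamma%:M \in unitmx.
Proof.
(* Row freeness concerns the left kernel; transposing turns it into the right kernel, where the
   energy identity forces both nonnegative terms to vanish. *)
move=> gamma0; rewrite -unitmx_tr -row_free_unit; apply: inj_row_free => v.
move=> /(congr1 trmx); rewrite trmx_mul trmxK trmx0 => Bv0.
have := dotmx_normal gamma v^T; rewrite Bv0 {1}/dotmx mulmx0 mxE => v0.
have vv0 : dotmx v^T v^T = 0.
  have := dotmx_ge0 (A *m v^T); have := dotmx_ge0 v^T; nra.
have := sqr_mx_norm_le_dotmx v^T; rewrite vv0 real_exprn_even_le0 ?num_real//=.
by rewrite normr_eq0 => /eqP vT0; rewrite -[v]trmxK vT0 trmx0.
Qed.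

Lemma dotmx_mulmx_lb : A \in unitmx ->
  exists2 c : R, 0 < c & forall x, c * dotmx x x <= dotmx (A *m x) (A *m x).
Proof.
(* From [x = A^-1 (A x)]: the outer [n] comes from bounding [dotmx] by the max norm, the inner one
   from the product bound. The added 1 keeps [K] positive, also for [n = 0]. *)
move=> Au; set K : R := n%:R * (n%:R * `|invmx A|) ^+ 2 + 1.
have K0 : 0 < K by rewrite ltr_wpDl// mulr_ge0// sqr_ge0.
exists K^-1; first by rewrite invr_gt0.
move=> x; rewrite ler_pdivrMl// -{1 2}(mulKmx Au x).
set z := A *m x; rewrite (le_trans (dotmx_le_sqr_mx_norm _))//.
have := mx_norm_mul (invmx A) z; rewrite mulrA => le1.
have le2 : `|invmx A *m z| ^+ 2 <= (n%:R * `|invmx A|) ^+ 2 * `|z| ^+ 2.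
  by rewrite -exprMn ler_sqr ?nnegrE ?mulr_ge0.
rewrite (le_trans (ler_wpM2l _ le2))// mulrA.
rewrite (le_trans (y := K * `|z| ^+ 2))//.
  by rewrite ler_wpM2r ?sqr_ge0// /K lerDl.
by rewrite ler_wpM2l ?(ltW K0)// sqr_mx_norm_le_dotmx.
Qed.

Lemma iter_tikhonov_cvg (gamma : R) (b g0 : 'cV[R]_n) :
  A \in unitmx -> 0 < gamma ->
  iter_tikhonov A gamma b g0 k @[k --> \oo] --> invmx A *m b.
Proof.
move=> Au gamma0; set x := invmx A *m b; set g := iter_tikhonov A gamma b g0.
have [c c0 lbA] := dotmx_mulmx_lb Au.
(* The energy estimate combined with [c |y|^2 <= |A y|^2] reads
   [(gamma + 2 c) |y|^2 <= gamma |e|^2]. *)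
set q := gamma / (gamma + 2 * c).
have q0 : 0 <= q by rewrite /q divr_ge0//; lra.
have step k : dotmx (g k.+1 - x) (g k.+1 - x) <= q * dotmx (g k - x) (g k - x).
  set e := g k - x; set y := g k.+1 - x.
  (* Since [b = A x], the residual is [- A e]. Multiplying the update by [A^T A + gamma I] then
     cancels [A^T A e]. *)
  have By : (A^T *m A + gamma%:M) *m y = gamma *: e.
    have res : b - A *m g k = - (A *m e).
      by rewrite /e mulmxBr /x mulKVmx// opprB.
    have -> : y = e - invmx (A^T *m A + gamma%:M) *m (A^T *m (A *m e)).
      rewrite /y (_ : g k.+1 =
        g k + invmx (A^T *m A + gamma%:M) *m (A^T *m (b - A *m g k)))//.
      by rewrite res !mulmxN addrAC.
    rewrite mulmxBr mulKVmx ?unitmx_normal// mulmxDl mulmxA addrAC subrr add0r.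
    by rewrite mul_scalar_mx.
  have := dotmx_normal gamma y; rewrite By.
  have -> : dotmx y (gamma *: e) = gamma * dotmx y e.
    by rewrite /dotmx -scalemxAr mxE.
  have := lbA y; have := dotmx_double y e.
  set ye := dotmx y e; set yy := dotmx y y; set ee := dotmx e e.
  move=> ye_le lby eqye.
  rewrite /q mulrAC ler_pdivlMr; last by lra.
  have : gamma * (2 * ye) <= gamma * (yy + ee) by rewrite ler_wpM2l// ltW.
  lra.
have geo k : dotmx (g k - x) (g k - x) <= q ^+ k * dotmx (g0 - x) (g0 - x).
  elim: k => [|k IH]; first by rewrite expr0 mul1r.
  by rewrite (le_trans (step k))// exprS -mulrA ler_wpM2l.
(* The decay so far is for squared lengths; square roots give the ratio and constant of a geometric
   bound on the max norm. *)
set s := Num.sqrt q; set C := Num.sqrt (dotmx (g0 - x) (g0 - x)).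
have s1 : `|s| < 1.
  rewrite ger0_norm ?sqrtr_ge0// -[ltRHS]sqrtr1 ltr_sqrt// /q ltr_pdivrMr; lra.
have gs k : `|x - g k| <= geometric C s k.
  rewrite distrC /geometric /= -ler_sqr ?nnegrE ?mulr_ge0 ?exprn_ge0 ?sqrtr_ge0//.
  rewrite (le_trans (sqr_mx_norm_le_dotmx _))// (le_trans (geo k))//.
  by rewrite [leRHS]exprMn [(s ^+ k) ^+ 2]exprAC !sqr_sqrtr ?dotmx_ge0// mulrC.
apply/cvgrPdist_le => eps eps0.
have /cvgrPdist_le/(_ eps eps0) := cvg_geometric C s1.
apply: filterS => k; rewrite sub0r normrN => Ck.
by rewrite (le_trans (gs k))// (le_trans (ler_norm _)).
Qed.

Lemma noisy_mx_norm (delta : R) b bd : 0 <= delta ->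
  noisy delta b bd -> `|bd - b| <= delta * `|b|.
Proof.
move=> delta0 bbd; apply: mx_norm_le => [|i j]; first by rewrite mulr_ge0.
rewrite (ord1 j) !mxE (le_trans (bbd i))// ler_wpM2l//.
exact: ler_entry_mx_norm.
Qed.

Lemma iter_tikhonov_regularization (gamma : R) (g0 b x : 'cV[R]_n)
    (bd : R -> 'cV[R]_n) :
  A \in unitmx -> 0 < gamma -> A *m x = b ->
  (forall delta, 0 < delta -> noisy delta b (bd delta)) ->
  `|limn (iter_tikhonov A gamma (bd delta) g0) - x|
    @[delta --> 0^'+] --> (0 : R).
Proof.
move=> Au gamma0 Axb bd_noisy.
(* The error of the limit is [A^-1 (bd delta - b)], so the product bound and the relative noise
   level give at most [delta * C]. *)
set C : R := n%:R * `|invmx A| * `|b|.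
apply: (@squeeze_cvgr _ _ _ _ (fun=> 0) (fun delta : R => delta * C)).
- near=> delta; rewrite normr_ge0 /=.
  have delta0 : 0 < delta by near: delta; exact: nbhs_right_gt.
  have -> : limn (iter_tikhonov A gamma (bd delta) g0) = invmx A *m bd delta.
    by apply: cvg_lim; [exact: norm_hausdorff|exact: iter_tikhonov_cvg].
  rewrite -(mulKmx Au x) Axb -mulmxBr (le_trans (mx_norm_mul _ _))//.
  rewrite /C mulrA [leRHS]mulrCA ler_wpM2l ?mulr_ge0//.
  exact: (noisy_mx_norm (ltW delta0) (bd_noisy _ delta0)).
- exact: cvg_cst.
- rewrite -[X in _ --> X](mul0r C).
  by apply: cvgM; [exact: cvg_within|exact: cvg_cst].
Unshelve. all: by end_near. Qed.

End Tikhonov.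

Lemma quad_mx_unit (R : realType) N (Dt : R) (w : R -> R) :
  Dt != 0 -> w (mesh Dt 1) != 0 -> quad_mx N Dt w \in unitmx.
Proof.
move=> Dt0 w0; rewrite unitmxE det_trig; last first.
  by apply/is_trig_mxP => i j ij; rewrite mxE ij.
(* Every diagonal entry samples [w] at the first mesh point: [i - i] leaves index 1, and in the
   halved first column the diagonal row has index 0, so its sample is at index 1 too. *)
rewrite unitfE; apply/prodf_neq0 => i _; rewrite mxE ltnn subnn.
by case: ifP => [/eqP->|_]; rewrite !mulf_neq0 ?invr_eq0 ?pnatr_eq0.
Qed.

Theorem proposition2 (R : realType)
    (d : nat) (d_ge1 : (1 <= d)%N) (d_le3 : (d <= 3)%N)
    (T : R) (T_gt0 : 0 < T)
    (alpha : R) (alpha_gt : 1 / 2 < alpha) (alpha_lt1 : alpha < 1)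
    (D : set 'rV[R]_d) (D_domain : C2_domain D)
    (kappa : 'rV[R]_d -> R) (kappa_coef : elliptic_coef D kappa)
    (g1 g2 : R -> R) (g1_Linfty : Linfty T g1) (g2_Linfty : Linfty T g2)
    (g1_sign : finitely_many_sign_changes T g1)
    (f : 'rV[R]_d -> R) (f_H2 : H2 D f) (f_H10 : H10 D f)
    (f_bounded : exists Cf : R, forall x, D x -> 0 <= f x <= Cf)
    (x0 : 'rV[R]_d) (x0_D : D x0)
    (x0_supp : ~ closure [set x | D x /\ f x != 0] x0)
    (v : 'rV[R]_d -> R -> R)
    (v_sol : subdiffusion_solution D kappa f alpha T v)
    (dO : measure_display) (Omega : measurableType dO)
    (P : probability Omega R)
    (W : R -> Omega -> R) (W_brownian : brownian P W)
    (Ig : R -> Omega -> R) (Ig_def : frac_int_noise P W alpha T g1 g2 Ig)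
    (u : 'rV[R]_d -> R -> Omega -> R)
    (u_sol : stochastic_weak_solution D kappa f alpha T Ig u)
    (u_formula : solution_formula D f T v Ig u)
    (N : nat) (N_gt0 : (0 < N)%N)
    (Dt : R) (Dt_def : Dt = T / N%:R)
    (v_pos : 0 < v x0 (mesh Dt 1))
    (A1 A2 : 'M[R]_N)
    (A1_def : A1 = quad_mx N Dt (v x0))
    (A2_def : A2 = quad_mx N Dt (fun t => v x0 t ^+ 2))
    (Evec Vvec : 'cV[R]_N)
    (Evec_def : Evec = \col_i mean_data P alpha (u x0) (mesh Dt i.+1))
    (Vvec_def : Vvec = \col_i variance_data P alpha (u x0) (mesh Dt i.+1))
    (g1vec g2vec : 'cV[R]_N)
    (g1vec_def : A1 *m g1vec = Evec) (g2vec_def : A2 *m g2vec = Vvec)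
    (Ed Vd : R -> 'cV[R]_N)
    (Ed_noisy : forall delta, 0 < delta -> noisy delta Evec (Ed delta))
    (Vd_noisy : forall delta, 0 < delta -> noisy delta Vvec (Vd delta))
    (gamma1 gamma2 : R) (gamma1_gt0 : 0 < gamma1) (gamma2_gt0 : 0 < gamma2)
    (g10 g20 : 'cV[R]_N) :
  (forall delta, 0 < delta ->
     cvgn (iter_tikhonov A1 gamma1 (Ed delta) g10) /\
     cvgn (iter_tikhonov A2 gamma2 (Vd delta) g20)) /\
  (`| limn (iter_tikhonov A1 gamma1 (Ed delta) g10) - g1vec | : R)
    @[delta --> 0^'+] --> (0 : R) /\
  (`| limn (iter_tikhonov A2 gamma2 (Vd delta) g20) - g2vec | : R)
    @[delta --> 0^'+] --> (0 : R).
Proof.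
have Dt0 : Dt != 0.
  by rewrite Dt_def mulf_neq0 ?invr_eq0 ?pnatr_eq0 ?gt_eqF.
have A1u : A1 \in unitmx by rewrite A1_def quad_mx_unit// gt_eqF.
have A2u : A2 \in unitmx by rewrite A2_def quad_mx_unit// expf_neq0// gt_eqF.
split=> [delta _|].
  by split; apply/cvg_ex; eexists; exact: iter_tikhonov_cvg.
by split; [exact: iter_tikhonov_regularization g1vec_def Ed_noisy|
           exact: iter_tikhonov_regularization g2vec_def Vd_noisy].
Qed.
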